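(* Let $G$ be a finite group. The map taking a $G$ transfer system $\mathcal{T}$ to its minimal fibrant subgroup restricts to an order-reversing bijection $\mathrm{BiSat}(G)\to\mathrm{Sub}_{\unlhd}(G)$ from the poset of bisaturated $G$ transfer systems to the lattice of normal subgroups of $G$.
   Context: A $G$ transfer system $\mathcal{T}$ is a partial order $\to_{\mathcal{T}}$ on the set of subgroups of $G$ such that: $K\to_{\mathcal{T}}H$ implies $K\le H$; if $L\to_{\mathcal{T}}H$ and $K\le H$ then $K\cap L\to_{\mathcal{T}}K$; if $K\to_{\mathcal{T}}H$ and $g\in G$ then $gKg^{-1}\to_{\mathcal{T}}gHg^{-1}$. Transfer systems are partially ordered by refinement: $\mathcal{T}\le\mathcal{S}$ iff $K\to_{\mathcal{T}}H$ implies $K\to_{\mathcal{S}}H$. The minimal fibrant subgroup of $\mathcal{T}$ is the unique minimal subgroup $M\le G$ with $M\to_{\mathcal{T}}G$ (it exists and is normal). $\mathcal{T}$ is saturated if whenever $L\le K\le H\le G$ and $L\to_{\mathcal{T}}H$, then $K\to_{\mathcal{T}}H$. $\mathcal{T}$ is disc-like if it is generated by a set of transfers of the form $\{H_i\to G\}_{i\in I}$, i.e. it is the smallest transfer system containing these relations. $\mathcal{T}$ is bisaturated if it is both saturated and disc-like; $\mathrm{BiSat}(G)$ is the set of bisaturated $G$ transfer systems, ordered by refinement. $\mathrm{Sub}_{\unlhd}(G)$ is ordered by inclusion. *)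

(* Defs.v *)
From mathcomp Require Import all_boot all_fingroup.

Set Implicit Arguments.
Unset Strict Implicit.
Unset Printing Implicit Defensive.

Local Open Scope group_scope.

(* A relation on the subgroups of G is encoded by its graph, so that
   refinement is inclusion and equality of relations is Leibniz equality. *)
Definition grel_set (gT : finGroupType) := {set {group gT} * {group gT}}.

Record transfer_system (gT : finGroupType) (G : {group gT})
    (T : grel_set gT) : Prop := TransferSystem {
  ts_dom : forall K H : {group gT},
    (K, H) \in T -> K \subset G /\ H \subset G;
  ts_refl : forall H : {group gT}, H \subset G -> (H, H) \in T;
  ts_anti : forall K H : {group gT},
    (K, H) \in T -> (H, K) \in T -> K = H;
  ts_trans : forall L K H : {group gT},
    (L, K) \in T -> (K, H) \in T -> (L, H) \in T;
  ts_sub : forall K H : {group gT}, (K, H) \in T -> K \subset H;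
  ts_restr : forall L K H : {group gT},
    (L, H) \in T -> K \subset H -> ((K :&: L)%G, K) \in T;
  (* A :^ x is x^-1 A x, hence the inverses *)
  ts_conj : forall (K H : {group gT}) (g : gT),
    (K, H) \in T -> g \in G -> ((K :^ g^-1)%G, (H :^ g^-1)%G) \in T
}.

(* [min M | P] says that M is minimal for inclusion among the groups
   satisfying P.  The default value G is never used when T is a transfer
   system: see min_fibrantP. *)
Definition min_fibrant (gT : finGroupType) (G : {group gT})
    (T : grel_set gT) : {group gT} :=
  odflt G [pick M : {group gT} | [min M | (M, G) \in T]].

Definition saturated (gT : finGroupType) (G : {group gT})
    (T : grel_set gT) : Prop :=
  forall L K H : {group gT},
    L \subset K -> K \subset H -> H \subset G -> (L, H) \in T -> (K, H) \in T.

Definition generated_by (gT : finGroupType) (G : {group gT})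
    (R T : grel_set gT) : Prop :=
  [/\ transfer_system G T, R \subset T &
      forall S : grel_set gT, transfer_system G S -> R \subset S -> T \subset S].

Definition disc_like (gT : finGroupType) (G : {group gT})
    (T : grel_set gT) : Prop :=
  exists X : {set {group gT}}, generated_by G [set (H, G) | H in X] T.

Definition bisaturated (gT : finGroupType) (G : {group gT})
    (T : grel_set gT) : Prop :=
  [/\ transfer_system G T, saturated G T & disc_like G T].

Lemma min_fibrantP (gT : finGroupType) (G : {group gT}) (T : grel_set gT) :
  transfer_system G T ->
  forall M : {group gT}, [min M | (M, G) \in T] <-> M = min_fibrant G T.
Proof.
move=> tsT.
have least (M L : {group gT}) :
    [min M | (M, G) \in T] -> (L, G) \in T -> M \subset L.
  case/mingroupP=> MG minM LG.
  have MLM : ((M :&: L)%G, M) \in T.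
    by apply: (ts_restr tsT LG); apply: ts_sub tsT _ _ MG.
  by apply/setIidPl; apply: minM; rewrite ?subsetIl // (ts_trans tsT MLM MG).
have min_unique (M N : {group gT}) :
    [min M | (M, G) \in T] -> [min N | (N, G) \in T] -> M = N.
  move=> mM mN; apply/val_inj/eqP; rewrite eqEsubset.
  by rewrite (least M N) ?(least N M) // ?(mingroupp mM) ?(mingroupp mN).
have mf : [min min_fibrant G T of M | (M, G) \in T].
  rewrite /min_fibrant; case: pickP => [//|noM].
  have [M mM _] : {M : {group gT} | [min M | (M, G) \in T] & M \subset G}.
    by apply: mingroup_exists; apply: (ts_refl tsT).
  by rewrite noM in mM.
by move=> M; split=> [mM|->//]; apply: min_unique.
Qed.

(* Main.v *)
(** For a normal subgroup N, let T_N relate K to H when K <= H <= G and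
    H ∩ N <= K.  This is a saturated transfer system with minimal fibrant
    subgroup N.  By the modular law K = H ∩ KN whenever K is related to H, so
    T_N is generated by the transfers from the subgroups containing N to G.
    A bisaturated T with minimal fibrant subgroup M equals T_M: generators of T
    lie in T_M since M is least among the L with L -> G, and conversely M -> G
    gives KM -> G by saturation, hence K = H ∩ KM -> H by restriction. *)
Require Import Defs.
From mathcomp Require Import all_boot all_fingroup.

Set Implicit Arguments.
Unset Strict Implicit.
Unset Printing Implicit Defensive.

Local Open Scope group_scope.

Definition trace_rel (gT : finGroupType) (G N : {group gT}) : grel_set gT :=
  [set KH : {group gT} * {group gT} |
    [&& KH.1 \subset KH.2, KH.2 \subset G & KH.2 :&: N \subset KH.1]].

Lemma in_trace_rel (gT : finGroupType) (G N K H : {group gT}) :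
  ((K, H) \in trace_rel G N)
  = [&& K \subset H, H \subset G & H :&: N \subset K].
Proof. by rewrite inE. Qed.

Lemma trace_relG (gT : finGroupType) (G N H : {group gT}) : N \subset G ->
  ((H, G) \in trace_rel G N) = (N \subset H) && (H \subset G).
Proof. by move=> sNG; rewrite in_trace_rel subxx (setIidPr sNG) andbC. Qed.

Lemma trace_rel_transfer (gT : finGroupType) (G N : {group gT}) :
  N <| G -> transfer_system G (trace_rel G N).
Proof.
case/andP=> _ nNG; split=> [K H|H sHG|K H|L K H|K H|L K H|K H g].
- by rewrite in_trace_rel => /and3P[sKH sHG _]; rewrite (subset_trans sKH).
- by rewrite in_trace_rel subxx sHG subsetIl.
- rewrite !in_trace_rel => /and3P[sKH _ _] /and3P[sHK _ _].
  by apply/val_inj/eqP; rewrite eqEsubset sKH.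
- rewrite !in_trace_rel => /and3P[sLK sKG sL] /and3P[sKH -> sK].
  rewrite (subset_trans sLK sKH) /=; apply: subset_trans sL.
  by rewrite subsetI sK subsetIr.
- by rewrite in_trace_rel => /and3P[].
- rewrite !in_trace_rel => /and3P[_ sHG sL] sKH.
  rewrite subsetIl (subset_trans sKH sHG) subsetI subsetIl /=.
  exact: subset_trans (setSI N sKH) sL.
- rewrite !in_trace_rel => /and3P[sKH sHG sK] Gg.
  have Gg' : g^-1 \in G by rewrite groupV.
  rewrite /= conjSg sKH -{1}(conjGid Gg') conjSg sHG /=.
  (* Normality of [N] enters here: $g^{-1}$ normalises [N], so conjugating by it commutes with
     intersecting with [N]. *)
  by rewrite -{1}(normP (subsetP nNG _ Gg')) -conjIg conjSg.
Qed.

Lemma trace_rel_saturated (gT : finGroupType) (G N : {group gT}) :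
  saturated G (trace_rel G N).
Proof.
move=> L K H sLK sKH sHG; rewrite !in_trace_rel sKH sHG => /and3P[_ _ sL].
exact: subset_trans sL sLK.
Qed.

(** Each $K \to H$ in [trace_rel G N] is the restriction to $H$ of $KN \to G$. This serves both for
    generation and for comparison with a bisaturated system. *)
Lemma trace_rel_sub (gT : finGroupType) (G N : {group gT})
    (T : grel_set gT) :
  N <| G -> transfer_system G T ->
  (forall H : {group gT}, N \subset H -> H \subset G -> (H, G) \in T) ->
  trace_rel G N \subset T.
Proof.
case/andP=> sNG nNG tsT NT; apply/subsetP=> -[K H].
rewrite in_trace_rel => /and3P[sKH sHG sHNK].
have sKG := subset_trans sKH sHG.
have KNT : ((K <*> N)%G, G) \in T.
  by apply: NT; rewrite /= ?joing_subr // join_subG sKG.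
(* As $K$ normalises $N$, the join is $KN$; the modular law gives $H \cap KN = K(H \cap N) = K$. *)
have -> : K = (H :&: (K <*> N))%G.
  apply/val_inj; rewrite /= norm_joinEl ?(subset_trans sKG) //.
  by rewrite setIC -group_modl // [N :&: H]setIC mulGSid.
exact: ts_restr tsT _ _ _ KNT sHG.
Qed.

Lemma trace_rel_disc_like (gT : finGroupType) (G N : {group gT}) :
  N <| G -> disc_like G (trace_rel G N).
Proof.
move=> nsNG; exists [set H : {group gT} | (N \subset H) && (H \subset G)].
split; first exact: trace_rel_transfer.
- apply/subsetP=> _ /imsetP[H + ->].
  by rewrite inE => XH; rewrite trace_relG // normal_sub.
- move=> S tsS sXS; apply: trace_rel_sub => // H sNH sHG.
  by apply: (subsetP sXS); apply/imsetP; exists H; rewrite // inE sNH.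
Qed.

Lemma trace_rel_bisaturated (gT : finGroupType) (G N : {group gT}) :
  N <| G -> bisaturated G (trace_rel G N).
Proof.
by move=> nsNG; split; [exact: trace_rel_transfer | exact: trace_rel_saturated
  | exact: trace_rel_disc_like].
Qed.

(** The subgroups with a transfer to $G$ are exactly those between $N$ and $G$. *)
Lemma min_fibrant_trace_rel (gT : finGroupType) (G N : {group gT}) :
  N <| G -> min_fibrant G (trace_rel G N) = N.
Proof.
move=> nsNG; apply/esym/(min_fibrantP (trace_rel_transfer nsNG)).
have sNG := normal_sub nsNG.
apply/mingroupP; rewrite trace_relG // subxx; split=> // H.
rewrite trace_relG // => /andP[sNH _] sHN.
by apply/eqP; rewrite eqEsubset sHN.
Qed.

Lemma min_fibrant_rel (gT : finGroupType) (G : {group gT})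
    (T : grel_set gT) :
  transfer_system G T -> (min_fibrant G T, G) \in T.
Proof.
by move=> tsT; have /mingroupp := (min_fibrantP tsT _).2 (erefl _).
Qed.

(** Restricting $L \to G$ to the minimal $M$ gives $M \cap L \to M \to G$, so $M \cap L = M$ by
    minimality. *)
Lemma min_fibrant_least (gT : finGroupType) (G L : {group gT})
    (T : grel_set gT) :
  transfer_system G T -> (L, G) \in T -> min_fibrant G T \subset L.
Proof.
move=> tsT LG; have MG := min_fibrant_rel tsT.
have /mingroupP[_ minM] := (min_fibrantP tsT _).2 (erefl _).
have MLM := ts_restr tsT LG (ts_sub tsT MG).
by apply/setIidPl/minM; rewrite ?subsetIl // (ts_trans tsT MLM MG).
Qed.

(** A conjugate of $M$ still has a transfer to $G$, hence contains the least such subgroup $M$. *)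
Lemma min_fibrant_normal (gT : finGroupType) (G : {group gT})
    (T : grel_set gT) :
  transfer_system G T -> min_fibrant G T <| G.
Proof.
move=> tsT; have MG := min_fibrant_rel tsT.
rewrite /normal (ts_sub tsT MG); apply/subsetP=> g Gg.
have := ts_conj tsT MG Gg.
have -> : (G :^ g^-1)%G = G by apply/val_inj/conjGid; rewrite groupV.
by move/(min_fibrant_least tsT); rewrite /= -sub_conjg inE.
Qed.

Lemma bisaturated_trace_rel (gT : finGroupType) (G : {group gT})
    (T : grel_set gT) :
  bisaturated G T -> T = trace_rel G (min_fibrant G T).
Proof.
case=> tsT satT [X [_ sXT minT]].
have nsMG := min_fibrant_normal tsT; have MG := min_fibrant_rel tsT.
apply/eqP; rewrite eqEsubset; apply/andP; split.
(* Since [T] is the least transfer system containing its generators, it suffices to place these in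
   [trace_rel]. *)
- apply: minT (trace_rel_transfer nsMG) _.
  apply/subsetP=> KH XKH; have := subsetP sXT _ XKH.
  case/imsetP: XKH => H _ -> HG.
  rewrite trace_relG; last exact: normal_sub.
  by rewrite (min_fibrant_least tsT HG) (ts_sub tsT HG).
- by apply: trace_rel_sub => // H sMH sHG; apply: satT sMH sHG _ MG.
Qed.

Theorem theorem2p4 (gT : finGroupType) (G : {group gT}) :
  [/\ (* well defined *)
      forall T : grel_set gT, bisaturated G T -> min_fibrant G T <| G,
      (* injective *)
      forall S T : grel_set gT, bisaturated G S -> bisaturated G T ->
        min_fibrant G S = min_fibrant G T -> S = T,
      (* surjective *)
      forall N : {group gT}, N <| G ->
        exists2 T : grel_set gT, bisaturated G T & min_fibrant G T = N
    & (* order-reversing, in both directions *)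
      forall S T : grel_set gT, bisaturated G S -> bisaturated G T ->
        (S \subset T <-> min_fibrant G T \subset min_fibrant G S)].
Proof.
split=> [T [tsT _ _]|S T bS bT eqM|N nsNG|S T bS bT].
- exact: min_fibrant_normal.
- by rewrite (bisaturated_trace_rel bS) eqM -bisaturated_trace_rel.
- exists (trace_rel G N); first exact: trace_rel_bisaturated.
  exact: min_fibrant_trace_rel.
- have [[tsS _ _] [tsT _ _]] := (bS, bT); split=> [sST|sM].
    exact/(min_fibrant_least tsT)/(subsetP sST)/min_fibrant_rel.
  (* In trace form the inclusion reads $H \cap M_T \le H \cap M_S \le K$. *)
  rewrite (bisaturated_trace_rel bS) (bisaturated_trace_rel bT).
  apply/subsetP=> -[K H]; rewrite !in_trace_rel => /and3P[-> -> sK] /=.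
  exact: subset_trans (setIS H sM) sK.
Qed.
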